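(* Let $\upsilon=\{\upsilon_n\}_{n\in\mathbb{Z}}\in\ell^{1}(\mathbb{Z})$ be a complex sequence and let $H_V=H_0+V$ be the associated discrete Schrödinger operator on $\ell^2(\mathbb{Z})$. Then $$\sigma_{\mathrm{p}}(H_V)\subset\Big\{\lambda\in\mathbb{C}\setminus(-2,2)\ \Big|\ |\lambda^2-4|\leq\|\upsilon\|_{\ell^1(\mathbb{Z})}^2\Big\}.$$
   Context: $\{e_n\}_{n\in\mathbb{Z}}$ is the standard basis of the complex Hilbert space $\ell^2(\mathbb{Z})$. The discrete Laplacian $H_0$ is the bounded operator on $\ell^2(\mathbb{Z})$ determined by $H_0e_n=e_{n-1}+e_{n+1}$ for all $n\in\mathbb{Z}$. For a bounded complex sequence $\upsilon=\{\upsilon_n\}_{n\in\mathbb{Z}}$, the potential $V$ is the diagonal operator $Ve_n=\upsilon_ne_n$, $n\in\mathbb{Z}$, and $H_V:=H_0+V$. $\sigma_{\mathrm{p}}(H_V)$ denotes the point spectrum, i.e. the set of eigenvalues of $H_V$ (with eigenvectors in $\ell^2(\mathbb{Z})$). $(-2,2)$ denotes the open real interval, regarded as a subset of $\mathbb{C}$. *)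

(* Defs.v *)
From HB Require Import structures.
From mathcomp Require Import all_boot all_order all_algebra.
From mathcomp Require Import all_classical all_reals all_analysis.
From mathcomp Require Import complex.
From mathcomp Require Import ring lra.

Set Implicit Arguments.
Unset Strict Implicit.
Unset Printing Implicit Defensive.

Import Order.TTheory GRing.Theory Num.Theory.
Import numFieldNormedType.Exports.

Local Open Scope classical_set_scope.
Local Open Scope ring_scope.

(* [normc] is the modulus with values in R; the ring norm [`|z|] on R[i] has
   its values in R[i]. *)
Notation normc := ComplexField.Normc.normc.

Section sequence_spaces.
Context {R : realType}.
Implicit Types u v w : int -> R[i].

Definition in_l1Z v : Prop := summable setT (fun n => (normc (v n))%:E).

(* Meaningful under [in_l1Z v], where the sum is finite. *)
Definition l1Z_norm v : R := fine (\esum_(n in setT) (normc (v n))%:E).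

Definition in_linfZ v : Prop := exists M : R, forall n, normc (v n) <= M.

Definition in_l2Z u : Prop := summable setT (fun n => (normc (u n) ^+ 2)%:E).

Lemma normc_ge0 (z : R[i]) : 0 <= normc z.
Proof. by case: z => a b; rewrite /= sqrtr_ge0. Qed.

Lemma ler_normcD (y z : R[i]) : normc (y + z) <= normc y + normc z.
Proof. exact: le_normcD. Qed.

Lemma sqr_normcD (y z : R[i]) :
  normc (y + z) ^+ 2 <= 2 * normc y ^+ 2 + 2 * normc z ^+ 2.
Proof.
have le1 : normc (y + z) ^+ 2 <= (normc y + normc z) ^+ 2.
  by rewrite ler_pXn2r ?nnegrE ?addr_ge0 ?normc_ge0 ?ler_normcD.
apply: le_trans le1 _; rewrite -subr_ge0.
have -> : 2 * normc y ^+ 2 + 2 * normc z ^+ 2 - (normc y + normc z) ^+ 2 =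
  (normc y - normc z) ^+ 2 by ring.
exact: sqr_ge0.
Qed.

Definition sqsum u : \bar R := \esum_(n in setT) (normc (u n) ^+ 2)%:E.

Lemma in_l2ZE u : in_l2Z u <-> (sqsum u < +oo)%E.
Proof.
rewrite /in_l2Z /summable /sqsum; under eq_esum => n _ do
  rewrite gee0_abs ?lee_fin ?exprn_ge0 ?normc_ge0//.
by [].
Qed.

Lemma sqsum_ge0 u : (0 <= sqsum u)%E.
Proof. by apply: esum_ge0 => n _; rewrite lee_fin exprn_ge0 ?normc_ge0. Qed.

Lemma sqsum_fin u : in_l2Z u -> sqsum u = (fine (sqsum u))%:E.
Proof.
by move=> /in_l2ZE su; rewrite fineK// ge0_fin_numE ?sqsum_ge0.
Qed.

Lemma sqsumZ_le (c : R) u w : 0 <= c ->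
  (forall n, normc (w n) <= c * normc (u n)) ->
  (sqsum w <= (c ^+ 2)%:E * sqsum u)%E.
Proof.
move=> c0 wu; apply: ub_ereal_sup => _ [A [fA _] <-].
apply: (@le_trans _ _ ((c ^+ 2)%:E * \sum_(x \in A) (normc (u x) ^+ 2)%:E)%E).
  rewrite !fsbig_finite//= !sumEFin -EFinM lee_fin mulr_sumr.
  apply: ler_sum => n _; rewrite -exprMn.
  by rewrite ler_pXn2r// ?nnegrE ?normc_ge0 ?mulr_ge0 ?normc_ge0.
apply: lee_wpmul2l; first by rewrite lee_fin sqr_ge0.
by apply: ereal_sup_ubound; exists A.
Qed.

Lemma sqsumD_le u w : (sqsum (fun n => (u n + w n)%R) <=
  2%:E * sqsum u + 2%:E * sqsum w)%E.
Proof.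
apply: ub_ereal_sup => _ [A [fA _] <-].
apply: (@le_trans _ _ (2%:E * \sum_(x \in A) (normc (u x) ^+ 2)%:E +
                       2%:E * \sum_(x \in A) (normc (w x) ^+ 2)%:E)%E).
  rewrite !fsbig_finite//= !sumEFin -!EFinM -EFinD lee_fin !mulr_sumr.
  rewrite -big_split/=; apply: ler_sum => n _; exact: sqr_normcD.
by apply: leeD; apply: lee_wpmul2l; rewrite ?lee_fin//;
  apply: ereal_sup_ubound; exists A.
Qed.

Lemma sqsum_shift (k : int) u : sqsum (fun n => u (n + k)) = sqsum u.
Proof.
rewrite /sqsum [RHS](@reindex_esum _ _ _ setT setT (fun n : int => n + k))//.
split => //; first by move=> x y _ _ /addIr.
by move=> y _; exists (y - k) => //; rewrite subrK.
Qed.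

Lemma in_l2ZD u w : in_l2Z u -> in_l2Z w -> in_l2Z (fun n => u n + w n).
Proof.
move=> /in_l2ZE su /in_l2ZE sw; apply/in_l2ZE.
apply: le_lt_trans (sqsumD_le u w) _.
by apply: lte_add_pinfty; apply: lte_mul_pinfty; rewrite ?lee_fin.
Qed.

Lemma in_l2ZM v u : in_linfZ v -> in_l2Z u -> in_l2Z (fun n => v n * u n).
Proof.
move=> [M vM] /in_l2ZE su; apply/in_l2ZE.
have M0 : 0 <= M by apply: le_trans (vM 0); exact: normc_ge0.
apply: le_lt_trans (@sqsumZ_le M u _ M0 _) _.
  by move=> n; rewrite ComplexField.Normc.normcM ler_wpM2r ?normc_ge0.
by apply: lte_mul_pinfty; rewrite ?lee_fin ?sqr_ge0.
Qed.

Lemma in_l2Z_shift (k : int) u : in_l2Z u -> in_l2Z (fun n => u (n + k)).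
Proof. by rewrite !in_l2ZE sqsum_shift. Qed.

Lemma in_l1Z_linfZ v : in_l1Z v -> in_linfZ v.
Proof.
move=> vl1; exists (fine (\esum_(n in setT) `|(normc (v n))%:E|%E)) => n.
rewrite -lee_fin fineK; last by rewrite -summableE.
apply: ereal_sup_ubound; exists [set n]; first by split.
by rewrite fsbig_set1 gee0_abs// lee_fin normc_ge0.
Qed.

End sequence_spaces.

Section l2Z.
Variable R : realType.

Definition l2Z_pred : {pred int -> R[i]} := [pred u | `[< in_l2Z u >]].

Record l2Z := L2Z { l2Z_seq :> int -> R[i]; _ : l2Z_seq \in l2Z_pred }.

HB.instance Definition _ := [isSub for l2Z_seq].
HB.instance Definition _ := [Choice of l2Z by <:].

Lemma l2Z_submod_closed : submod_closed l2Z_pred.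
Proof.
split=> [|a u w].
  apply/asboolP/in_l2ZE; rewrite /sqsum esum1// => n _.
  by rewrite ComplexField.Normc.normc0 expr0n.
move=> /asboolP ul2 /asboolP wl2; apply/asboolP; apply: in_l2ZD => //.
by apply: (@in_l2ZM _ (fun=> a)) => //; exists (normc a).
Qed.

HB.instance Definition _ :=
  GRing.isSubmodClosed.Build R[i] (int -> R[i]) l2Z_pred l2Z_submod_closed.
HB.instance Definition _ := [SubChoice_isSubLmodule of l2Z by <:].

Lemma l2ZP (u : l2Z) : in_l2Z u.
Proof. by case: u => u /= /asboolP. Qed.

Definition mkl2Z (u : int -> R[i]) (ul2 : in_l2Z u) : l2Z :=
  @L2Z u (introT (asboolP _) ul2).

Definition l2Z_norm (u : l2Z) : R := Num.sqrt (fine (sqsum u)).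

Definition bounded_operator (T : l2Z -> l2Z) : Prop :=
  linear T /\ exists M : R, forall u, l2Z_norm (T u) <= M * l2Z_norm u.

Definition point_spectrum (T : l2Z -> l2Z) : set R[i] :=
  [set lambda | exists2 u : l2Z, u != 0 & T u = lambda *: u].

Lemma std_basis_subproof (n : int) : in_l2Z (fun m => (m == n)%:R : R[i]).
Proof.
apply/in_l2ZE; rewrite /sqsum (esumID [set n])//; last first.
  by move=> m _; rewrite lee_fin sqr_ge0.
rewrite !setTI esum_set1 ?lee_fin ?sqr_ge0// esum1 ?adde0 ?ltry//.
by move=> m /= /eqP/negbTE ->; rewrite ComplexField.Normc.normc0 expr0n.
Qed.

Definition std_basis (n : int) : l2Z := mkl2Z (std_basis_subproof n).

Lemma laplacian_subproof (u : l2Z) : in_l2Z (fun n => u (n - 1) + u (n + 1)).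
Proof. by apply: in_l2ZD; apply: in_l2Z_shift; exact: l2ZP. Qed.

Definition laplacian (u : l2Z) : l2Z := mkl2Z (laplacian_subproof u).

Definition potential v (vb : in_linfZ v) (u : l2Z) : l2Z :=
  mkl2Z (in_l2ZM vb (l2ZP u)).

Definition schrodinger v (vb : in_linfZ v) (u : l2Z) : l2Z :=
  laplacian u + potential vb u.

Lemma l2Z_eqP (u w : l2Z) : (forall n, u n = w n) -> u = w.
Proof. by move=> uw; apply/val_inj/funext. Qed.

Lemma l2Z_linE (a : R[i]) (u w : l2Z) n : (a *: u + w) n = a * u n + w n.
Proof. by []. Qed.

Lemma laplacian_basis n : laplacian (std_basis n) = std_basis (n - 1) + std_basis (n + 1).
Proof.
apply: l2Z_eqP => m /=; rewrite addrC subr_eq; congr (_ + _).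
by congr (_%:R); congr nat_of_bool; apply/eqP/eqP => [<-|->]; rewrite ?addrK ?subrK.
Qed.

Lemma potential_basis v (vb : in_linfZ v) n : potential vb (std_basis n) = v n *: std_basis n.
Proof.
apply: l2Z_eqP => m /=.
rewrite -[RHS]/(v n * (m == n)%:R); case: eqVneq => [->//|_].
by rewrite !mulr0.
Qed.

Lemma bounded_operatorP (T : l2Z -> l2Z) (M : R) : linear T -> 0 <= M ->
  (forall u, sqsum (T u) <= (M ^+ 2)%:E * sqsum u)%E -> bounded_operator T.
Proof.
move=> linT M0 TM; split=> //; exists M => u.
have := TM u; rewrite (sqsum_fin (l2ZP u)) (sqsum_fin (l2ZP (T u))) -EFinM lee_fin.
rewrite /l2Z_norm => le1; rewrite -[M in leRHS]ger0_norm// -sqrtr_sqr.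
by rewrite -sqrtrM ?sqr_ge0// ler_wsqrtr.
Qed.

Lemma laplacian_bounded : bounded_operator laplacian.
Proof.
apply: (@bounded_operatorP _ 2) => // [a u w|u].
  apply: l2Z_eqP => n; rewrite l2Z_linE.
  rewrite -[LHS]/((a * u (n - 1) + w (n - 1)) + (a * u (n + 1) + w (n + 1))).
  rewrite -[RHS]/(a * (u (n - 1) + u (n + 1)) + (w (n - 1) + w (n + 1))); ring.
apply: le_trans (sqsumD_le _ _) _.
rewrite (sqsum_shift (-1) u) sqsum_shift -ge0_muleDl ?lee_fin// -EFinD.
by rewrite lee_wpmul2r ?sqsum_ge0// lee_fin expr2; lra.
Qed.

Lemma potential_bounded v (vb : in_linfZ v) : bounded_operator (potential vb).
Proof.
case: (vb) => M vM; have M0 : 0 <= M by apply: le_trans (vM 0); exact: normc_ge0.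
apply: (@bounded_operatorP _ M) => // [a u w|u].
  apply: l2Z_eqP => n; rewrite l2Z_linE.
  rewrite -[LHS]/(v n * (a * u n + w n)).
  rewrite -[RHS]/(a * (v n * u n) + v n * w n); ring.
apply: sqsumZ_le => // n.
by rewrite ComplexField.Normc.normcM ler_wpM2r ?normc_ge0.
Qed.

Lemma l2Z_coord_le (u : l2Z) n : normc (u n) <= l2Z_norm u.
Proof.
rewrite -[leLHS]ger0_norm ?normc_ge0// -sqrtr_sqr ler_wsqrtr//.
rewrite -lee_fin -(sqsum_fin (l2ZP u)).
by apply: ereal_sup_ubound; exists [set n]; rewrite ?fsbig_set1.
Qed.

Lemma l2Z_sumE (s : seq int) (F : int -> l2Z) n :
  (\sum_(i <- s) F i) n = \sum_(i <- s) F i n.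
Proof. by elim: s => [|i s ih]; rewrite ?(big_nil,big_cons)//= -ih. Qed.

Lemma l2Z_dense (u : l2Z) (eps : R) : 0 < eps ->
  exists s : seq int, l2Z_norm (u - \sum_(n <- s) u n *: std_basis n) < eps.
Proof.
move=> eps0; have ul2 := l2ZP u.
have e2 : 0 < eps ^+ 2 by rewrite exprn_gt0.
have sufin : sqsum u \is a fin_num by rewrite (sqsum_fin ul2).
have [_ [A [finA _] <-] ltA] := ub_ereal_sup_adherent e2 sufin.
exists (finmap.enum_fset (fset_set A)).
set w := u - _.
have fsE i : (i \in finmap.enum_fset (fset_set A)) = (i \in A).
  by rewrite -in_fset_set.
have wE n : w n = if n \in A then 0 else u n.
  have -> : w n = u n - \sum_(i <- finmap.enum_fset (fset_set A)) u i * (n == i)%:R.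
    by congr (_ - _); exact: l2Z_sumE.
  case: ifPn => nA.
    rewrite (bigD1_seq n) ?fsE ?finmap.fset_uniq//= eqxx mulr1 big1 ?addr0 ?subrr// => i.
    by rewrite eq_sym => /negbTE ->; rewrite mulr0.
  rewrite big1_seq ?subr0// => i /=; rewrite fsE => iA.
  by case: eqP => [ni|]; rewrite ?mulr0//; move: nA; rewrite ni iA.
have ge0 (x : int -> R[i]) n : (0 <= (normc (x n) ^+ 2)%:E)%E.
  by rewrite lee_fin sqr_ge0.
have sw : sqsum w = \esum_(n in ~` A) (normc (u n) ^+ 2)%:E.
  rewrite /sqsum (esumID A)// !setTI esum1 ?add0e.
    by apply: eq_esum => n nA; rewrite wE; case: ifPn => //; rewrite inE => /nA.
  move=> n An; rewrite wE mem_set//.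
  by rewrite ComplexField.Normc.normc0 expr0n.
have su : sqsum u = (\sum_(n \in A) (normc (u n) ^+ 2)%:E + sqsum w)%E.
  by rewrite sw /sqsum (esumID A)// !setTI esum_fset.
have : (sqsum w < (eps ^+ 2)%:E)%E.
  have : (sqsum u - (eps ^+ 2)%:E < \sum_(n \in A) (normc (u n) ^+ 2)%:E)%E := ltA.
  rewrite su fsbig_finite//= sumEFin.
  rewrite (sqsum_fin (l2ZP w)) -EFinD !lte_fin.
  by move: (\sum_(_ <- _) _) (fine _) => a b; lra.
rewrite (sqsum_fin (l2ZP w)) lte_fin => lt1.
by rewrite /l2Z_norm -[ltRHS]gtr0_norm// -sqrtr_sqr ltr_sqrt.
Qed.

(* A bounded operator is determined by its values on the standard basis; hence
   [laplacian] and [potential] are the bounded operators characterized by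
   [laplacian_basis] and [potential_basis]. *)
Lemma bounded_operator_ext (S T : l2Z -> l2Z) :
  bounded_operator S -> bounded_operator T ->
  (forall n, S (std_basis n) = T (std_basis n)) -> S =1 T.
Proof.
move=> [linS [M SM]] [linT [N TN]] ST u.
pose S' : {linear l2Z -> l2Z} := HB.pack S (GRing.isLinear.Build _ _ _ _ S linS).
pose T' : {linear l2Z -> l2Z} := HB.pack T (GRing.isLinear.Build _ _ _ _ T linT).
apply: l2Z_eqP => n; apply/eqP; rewrite -subr_eq0; apply/eqP.
apply: ComplexField.Normc.eq0_normc; apply/eqP; rewrite eq_le normc_ge0 andbT.
set K := `|M| + `|N| + 1.
have K0 : 0 < K by rewrite ltr_wpDl ?addr_ge0.
apply/ler_addgt0Pr => eps eps0; rewrite add0r.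
have [s] := l2Z_dense u (divr_gt0 eps0 K0).
set p := \sum_(i <- s) _ => up.
have Sp : S p = T p.
  rewrite -[S p]/(S' p) -[T p]/(T' p) /p !linear_sum; apply: eq_bigr => i _.
  by rewrite !linearZ /= ST.
have -> : S u n - T u n = S (u - p) n - T (u - p) n.
  rewrite -[S (u - p)]/(S' (u - p)) -[T (u - p)]/(T' (u - p)) (linearB S') (linearB T').
  by rewrite -[RHS]/((S u n - S p n) - (T u n - T p n)) Sp; ring.
apply: le_trans (ler_normcD _ _) _; rewrite normcN.
have := l2Z_coord_le (S (u - p)) n; have := l2Z_coord_le (T (u - p)) n.
have := SM (u - p); have := TN (u - p).
have : 0 <= l2Z_norm (u - p) by exact: sqrtr_ge0.
move: up; rewrite ltr_pdivlMr// /K.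
have := ler_norm M; have := ler_norm N.
move: (normc _) (normc _) (l2Z_norm (S _)) (l2Z_norm (T _)) (l2Z_norm _) => a b c d x.
move: (`|M|) (`|N|) => M' N' NN MM xe x0 dN cM bd ac.
have := ler_wpM2r x0 NN; have := ler_wpM2r x0 MM; lra.
Qed.

End l2Z.

(* Main.v *)
(* Write lambda = z + 1/z with |z| <= 1.  For an eigenvector u, the sequences
   a n = u (n + 1) - z u n and b n = u (n + 1) - z^-1 u n satisfy first-order
   recurrences whose only source term is v u, and (z^-1 - z) u = a - b.
   Contraction by z bounds |a n| by the sum of |v k u k| over k > n (a vanishes
   at +oo) and |b n| by the same sum over k <= n (b vanishes at -oo), so
   |z^-1 - z| sup |u| <= ||v||_1 sup |u|, where (z^-1 - z)^2 = lambda^2 - 4.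
   If lambda lies in (-2, 2) then |z| = 1, both recurrences can be run from
   +oo, and a discrete Gronwall argument for |a| + |b| forces u = 0. *)
Require Import Defs.
From mathcomp Require Import all_boot all_order all_algebra.
From mathcomp Require Import all_classical all_reals all_analysis.
From mathcomp Require Import complex.
From mathcomp Require Import ring lra zify.

Import Order.TTheory GRing.Theory Num.Theory.

Local Open Scope classical_set_scope.
Local Open Scope ring_scope.
Local Open Scope complex_scope.

(** * Finite sums of summable sequences and decay of square-summable ones *)

Lemma normcM (R : realType) (x y : R[i]) : normc (x * y) = normc x * normc y.
Proof. exact: ComplexField.Normc.normcM. Qed.

Lemma ler_sum_l1Z_norm (R : realType) (v : int -> R[i]) (s : seq int) :
  in_l1Z v -> uniq s -> \sum_(k <- s) normc (v k) <= l1Z_norm v.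
Proof.
move=> vl1 us; have norm_lt : (\esum_(n in setT) (normc (v n))%:E < +oo)%E.
  by move: vl1; rewrite /in_l1Z /summable; under eq_esum => n _ do
    rewrite gee0_abs ?lee_fin ?normc_ge0//.
rewrite /l1Z_norm -lee_fin fineK.
  rewrite -sumEFin fsbig_seq//; apply: ereal_sup_ubound.
  by exists [set` s] => //; split => //; exact: finite_seq.
by rewrite ge0_fin_numE// esum_ge0// => n _; rewrite lee_fin normc_ge0.
Qed.

Lemma ler_sum_window (R : realType) (v : int -> R[i]) (m : int) (N : nat) :
  in_l1Z v -> \sum_(i < N) normc (v (m + i%:Z)) <= l1Z_norm v.
Proof.
move=> vl1; have := @ler_sum_l1Z_norm R v [seq m + i%:Z | i <- iota 0 N] vl1.
rewrite big_map -[X in iota 0 X]subn0 -/(index_iota 0 N) big_mkord; apply.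
by rewrite map_inj_uniq ?iota_uniq// => i j /addrI [].
Qed.

(** A finite truncation of [u] is [eps]-close in norm; off its support the difference has coordinate
    [u n], and a coordinate is at most the norm. *)
Lemma l2Z_vanish (R : realType) (u : l2Z R) (eps : R) : 0 < eps ->
  exists M : nat, forall n : int, (M <= `|n|)%N -> normc (u n) < eps.
Proof.
move=> /(l2Z_dense u)[s us].
exists (\max_(k <- s) `|k|).+1 => n nM.
have ns : n \notin s.
  by apply/negP => ns; have := @leq_bigmax_seq _ s xpredT absz n ns isT; rewrite leqNgt nM.
apply: le_lt_trans us; have := l2Z_coord_le (u - \sum_(k <- s) u k *: std_basis R k) n.
congr (normc _ <= _).
rewrite -[LHS]/(u n - (\sum_(k <- s) u k *: std_basis R k) n) l2Z_sumE.
rewrite big1_seq ?subr0// => k /andP[_ ks].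
rewrite -[LHS]/(u k * (n == k)%:R); case: eqP => [nk|]; rewrite ?mulr0//.
by rewrite nk ks in ns.
Qed.

(** * Iterating one-step inequalities *)

Lemma ler_telescope_window {R : realType} (f g : int -> R) :
  (forall n, f n <= f (n + 1) + g (n + 1)) ->
  forall n (N : nat), f n <= f (n + N%:Z) + \sum_(i < N) g (n + 1 + i%:Z).
Proof.
move=> fg n; elim=> [|N IH]; first by rewrite big_ord0 !addr0.
rewrite big_ord_recr/= addrCA addrC; apply: le_trans IH _.
have := fg (n + N%:Z).
have -> : n + N%:Z + 1 = n + N.+1%:Z by lia.
have -> : n + 1 + N%:Z = n + N.+1%:Z by lia.
lra.
Qed.

(** Each factor is absorbed by 1 + x <= exp x, so the product becomes the exponential of a sum. *)
Lemma gronwall_window {R : realType} (f g : int -> R) :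
  (forall n, 0 <= f n) ->
  (forall n, f n <= f (n + 1) * (1 + g (n + 1))) ->
  forall n (N : nat), f n <= f (n + N%:Z) * expR (\sum_(i < N) g (n + 1 + i%:Z)).
Proof.
move=> f0 fg n; elim=> [|N IH]; first by rewrite big_ord0 expR0 mulr1 addr0.
rewrite big_ord_recr/= addrC expRD mulrA; apply: le_trans IH _.
apply: ler_wpM2r; first exact: expR_ge0.
have := fg (n + N%:Z).
have -> : n + N%:Z + 1 = n + N.+1%:Z by lia.
have -> : n + 1 + N%:Z = n + N.+1%:Z by lia.
by move=> /le_trans; apply; rewrite ler_wpM2l// expR_ge1Dx.
Qed.

(** * First-order recurrences from the eigenvalue equation *)

(** With [E] the shift, this is [E - z] applied to [u]. If [z * w = 1] and [z + w = lambda], then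
    [E - z] and [E - w] are the factors of the free operator E^2 - lambda E + 1. *)
Definition jump {R : realType} (z : R[i]) (u : int -> R[i]) (n : int) : R[i] :=
  u (n + 1) - z * u n.

Lemma jump_le {R : realType} (z : R[i]) (u : int -> R[i]) n :
  normc (jump z u n) <= normc (u (n + 1)) + normc z * normc (u n).
Proof. by rewrite -normcM -(normcN (z * u n)) ler_normcD. Qed.

Section eigenvector.
Context {R : realType}.
Variables (v u : int -> R[i]) (lambda : R[i]).
Hypothesis eigen : forall n, u (n - 1) + u (n + 1) + v n * u n = lambda * u n.

Lemma jump_rec {z w : R[i]} {n} : z * w = 1 -> z + w = lambda ->
  w * jump z u n = jump z u (n + 1) + v (n + 1) * u (n + 1).
Proof.
move=> zw zDw; have := eigen (n + 1); rewrite addrK -zDw /jump => e.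
have -> : u (n + 1 + 1) = (z + w) * u (n + 1) - u n - v (n + 1) * u (n + 1).
  by rewrite -e; ring.
have -> : w * (u (n + 1) - z * u n) = w * u (n + 1) - (z * w) * u n by ring.
rewrite zw; ring.
Qed.

Lemma jump_backward_le {z w : R[i]} n : z * w = 1 -> z + w = lambda ->
  normc z <= 1 ->
  normc (jump z u n) <=
    normc (jump z u (n + 1)) + normc (v (n + 1)) * normc (u (n + 1)).
Proof.
move=> zw zDw z1; rewrite -normcM; apply: le_trans (ler_normcD _ _).
by rewrite -(jump_rec zw zDw) -[X in normc X <= _]mul1r -zw -mulrA normcM ler_piMl ?normc_ge0.
Qed.

(** The recurrence is symmetric in the roots; once they are exchanged, the contracting factor [z]
    multiplies the earlier jump, so the estimate runs the other way. *)
Lemma jump_forward_le {z w : R[i]} n : z * w = 1 -> z + w = lambda ->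
  normc z <= 1 ->
  normc (jump w u (n + 1)) <=
    normc (jump w u n) + normc (v (n + 1)) * normc (u (n + 1)).
Proof.
move=> zw zDw z1; rewrite -normcM.
have -> : jump w u (n + 1) = z * jump w u n + - (v (n + 1) * u (n + 1)).
  by rewrite (@jump_rec w z) 1?mulrC 1?addrC//; ring.
by apply: le_trans (ler_normcD _ _) _; rewrite normcN lerD2r normcM ler_piMl ?normc_ge0.
Qed.

Lemma normc_jump (z w : R[i]) n :
  normc (w - z) * normc (u n) <= normc (jump z u n) + normc (jump w u n).
Proof.
rewrite -normcM; have -> : (w - z) * u n = jump z u n + - jump w u n.
  by rewrite /jump; ring.
by rewrite -(normcN (jump w u n)) ler_normcD.
Qed.

End eigenvector.

(** * The pointwise estimate for eigenvectors *)

Lemma ler_sum_mul_l1Z_norm {R : realType} (v u : int -> R[i]) (S : R)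
    (s : seq int) : in_l1Z v -> uniq s -> 0 <= S ->
  (forall n, normc (u n) <= S) ->
  \sum_(k <- s) normc (v k) * normc (u k) <= l1Z_norm v * S.
Proof.
move=> vl1 us S0 uS; apply: le_trans (ler_wpM2r S0 (ler_sum_l1Z_norm _ _ _ vl1 us)).
by rewrite mulr_suml; apply: ler_sum => k _; rewrite ler_wpM2l ?normc_ge0.
Qed.

(** The two jumps are traced to opposite ends, so their sources lie on opposite sides of [n] and
    each index is charged to the l1 norm only once. *)
Lemma normc_eigen_le {R : realType} {v : int -> R[i]} {u : l2Z R}
    {lambda z w : R[i]} (S : R) : in_l1Z v -> 0 <= S ->
  (forall n, u (n - 1) + u (n + 1) + v n * u n = lambda * u n) ->
  z * w = 1 -> z + w = lambda -> normc z <= 1 ->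
  (forall n, normc (u n) <= S) ->
  forall n, normc (w - z) * normc (u n) <= l1Z_norm v * S.
Proof.
move=> vl1 S0 eigen zw zDw z1 uS n.
apply: le_trans (normc_jump _ _ _ _) _.
pose g k := normc (v k) * normc (u k).
have right_le := ler_telescope_window (fun k => normc (jump z u k)) g
  (fun k => jump_backward_le _ _ _ eigen k zw zDw z1) n.
(* Reflecting the index turns the forward estimate into the form that [ler_telescope_window]
   accepts. *)
have left_rec k : normc (jump w u (- k)) <=
    normc (jump w u (- (k + 1))) + g (1 - (k + 1)).
  have := jump_forward_le _ _ _ eigen (- (k + 1)) zw zDw z1.
  have -> : - (k + 1) + 1 = - k by lia.
  by rewrite /g; have -> : 1 - (k + 1) = - k by lia.
have left_le := ler_telescope_window (fun k => normc (jump w u (- k)))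
  (fun k => g (1 - k)) left_rec (- n).
(* The windows are n + 1, ..., n + N and n - N + 1, ..., n, which are disjoint. *)
have sum_le (N : nat) : \sum_(i < N) g (n + 1 + i%:Z) +
    \sum_(i < N) g (1 - (- n + 1 + i%:Z)) <= l1Z_norm v * S.
  have -> : \sum_(i < N) g (n + 1 + i%:Z) + \sum_(i < N) g (1 - (- n + 1 + i%:Z)) =
    \sum_(k <- [seq n + 1 + i%:Z | i <- iota 0 N] ++
               [seq 1 - (- n + 1 + i%:Z) | i <- iota 0 N]) g k.
    by rewrite big_cat !big_map -[X in iota 0 X]subn0 -/(index_iota 0 N) !big_mkord.
  apply: ler_sum_mul_l1Z_norm => //; rewrite cat_uniq !map_inj_uniq ?iota_uniq/=.
  - rewrite andbT; apply/hasPn => _ /mapP[i _ ->]; apply/mapP => -[j _]; lia.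
  - by move=> i j; lia.
  - by move=> i j; lia.
apply/ler_addgt0Pr => eps eps0.
have w0 := normc_ge0 w.
(* The two boundary jumps cost at most [e + e] and [e + normc w * e], whence the divisor
   [3 + normc w]. *)
have [M uM] : exists M : nat, forall k : int, (M <= `|k|)%N ->
    normc (u k) <= eps / (3 + normc w).
  have [|M uM] := l2Z_vanish _ u (eps / (3 + normc w)).
    by rewrite divr_gt0// ltr_wpDr.
  by exists M => k /uM/ltW.
set e := eps / _ in uM.
have eE : e * (3 + normc w) = eps by rewrite /e divfK// gt_eqF// ltr_wpDr.
(* The extra 1 keeps the index n - N + 1 of the left boundary jump at distance at least [M] from
   0. *)
pose N := (M + `|n| + 1)%N.
have ja : normc (jump z u (n + N%:Z)) <= e + e.
  apply: le_trans (jump_le _ _ _) _; apply: lerD; first by apply: uM; lia.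
  by apply: le_trans (ler_piMl (normc_ge0 _) z1) _; apply: uM; lia.
have jb : normc (jump w u (- (- n + N%:Z))) <= e + normc w * e.
  apply: le_trans (jump_le _ _ _) _; apply: lerD; first by apply: uM; lia.
  by rewrite ler_wpM2l//; apply: uM; lia.
have := right_le N; have := left_le N; have := sum_le N.
by rewrite opprK; lra.
Qed.

(** * Absence of eigenvalues in the open interval *)

(** Neither root expands, so the backward estimate holds for both jumps; as the roots differ, [u] is
    controlled by the jumps, which closes the Gronwall loop. *)
Lemma eigen_interior_eq0 {R : realType} {v : int -> R[i]} {u : l2Z R}
    {lambda z w : R[i]} : in_l1Z v ->
  (forall n, u (n - 1) + u (n + 1) + v n * u n = lambda * u n) ->
  z * w = 1 -> z + w = lambda -> normc z = 1 -> normc w = 1 -> z != w ->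
  forall n, u n = 0.
Proof.
move=> vl1 eigen zw zDw z1 w1 neq n.
have wz : w * z = 1 by rewrite mulrC.
have wDz : w + z = lambda by rewrite addrC.
have d0 : 0 < normc (w - z).
  rewrite lt_neqAle normc_ge0 andbT eq_sym; apply: contra neq => /eqP.
  by move=> /ComplexField.Normc.eq0_normc/subr0_eq ->.
set d := normc (w - z) in d0 *.
pose W k := normc (jump z u k) + normc (jump w u k).
have W0 k : 0 <= W k by rewrite addr_ge0 ?normc_ge0.
have uW k : normc (u k) <= W k / d by rewrite ler_pdivlMr// mulrC normc_jump.
have step k : W k <= W (k + 1) * (1 + 2 / d * normc (v (k + 1))).
  have := jump_backward_le _ _ _ eigen k zw zDw.
  have := jump_backward_le _ _ _ eigen k wz wDz.
  rewrite z1 w1 lexx => /(_ isT) hw /(_ isT) hz.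
  have := ler_wpM2l (normc_ge0 (v (k + 1))) (uW (k + 1)).
  have -> : W (k + 1) * (1 + 2 / d * normc (v (k + 1))) =
    W (k + 1) + 2 * (normc (v (k + 1)) * (W (k + 1) / d)) by ring.
  by move: hw hz; rewrite /W; lra.
pose C := expR (2 / d * l1Z_norm v).
have WC (N : nat) : W n <= W (n + N%:Z) * C.
  apply: le_trans (gronwall_window W (fun k => 2 / d * normc (v k)) W0 step n N) _.
  rewrite ler_wpM2l// ler_expR -mulr_sumr ler_wpM2l ?divr_ge0 ?(ltW d0)//.
  exact: ler_sum_window.
have C0 : 0 < C by exact: expR_gt0.
have Wn : W n <= 0.
  apply/ler_addgt0Pr => eps eps0; rewrite add0r.
  (* [W] far out is bounded by four values of [normc (u _)], two for each jump. *)
  have e4 : 0 < eps / C / 4 by rewrite !divr_gt0.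
  have [M uM] := l2Z_vanish _ u _ e4.
  apply: le_trans (WC (M + `|n|)%N) _; rewrite -ler_pdivlMr//.
  have small := uM (n + (M + `|n|)%N%:Z) ltac:(lia).
  have small1 := uM (n + (M + `|n|)%N%:Z + 1) ltac:(lia).
  have := jump_le z u (n + (M + `|n|)%N%:Z); rewrite z1.
  have := jump_le w u (n + (M + `|n|)%N%:Z); rewrite w1.
  by rewrite /W; lra.
apply: ComplexField.Normc.eq0_normc; apply/eqP; rewrite eq_le normc_ge0 andbT.
by apply: le_trans (uW n) _; rewrite ler_pdivrMr// mul0r.
Qed.

(** * Suprema of eigenvectors and choice of the roots *)

Lemma sup_l2Z {R : realType} (u : l2Z R) (S := sup (range (fun n => normc (u n)))) :
  (forall n, normc (u n) <= S) /\
  forall c M : R, (forall n, c * normc (u n) <= M) -> 0 <= c -> c * S <= M.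
Proof.
have ubS : has_sup (range (fun n => normc (u n))).
  split; first by exists (normc (u 0)), 0.
  by exists (l2Z_norm u) => _ [n _ <-]; exact: l2Z_coord_le.
split=> [n|c M cM]; first by apply: sup_upper_bound => //; exists n.
rewrite le_eqVlt => /predU1P[c0|c0].
  by have := cM 0; rewrite -c0 !mul0r.
rewrite mulrC -ler_pdivlMr//; apply: ge_sup; first by case: ubS.
by move=> _ [n _ <-]; rewrite ler_pdivlMr// mulrC.
Qed.

Lemma l2Z_neq0 {R : realType} (u : l2Z R) : u != 0 -> exists n, u n != 0.
Proof.
move=> u0; apply: contrapT => /forallNP un; move/negP: u0; apply; apply/eqP.
by apply: l2Z_eqP => n; have /negP := un n; rewrite negbK => /eqP.
Qed.

(** The roots of X^2 - lambda X + 1 have product 1, so they cannot both lie outside the closed unit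
    disc. *)
Lemma exists_small_root {R : realType} (lambda : R[i]) : exists z w : R[i],
  [/\ z * w = 1, z + w = lambda & normc z <= 1].
Proof.
pose r := sqrtC (lambda ^+ 2 - 4).
have r2 : r ^+ 2 = lambda ^+ 2 - 4 by exact: sqrtCK.
pose z := (lambda + r) / 2; pose w := (lambda - r) / 2.
have zw : z * w = 1.
  have -> : z * w = (lambda ^+ 2 - r ^+ 2) / 4 by rewrite /z /w; field.
  by rewrite r2; field.
have zDw : z + w = lambda by rewrite /z /w; field.
have [z1|z1] := leP (normc z) 1; first by exists z, w.
exists w, z; split; rewrite 1?mulrC 1?addrC//.
have : normc z * normc w = 1 by rewrite -normcM zw ComplexField.Normc.normc1.
have := normc_ge0 w; move: z1; nra.
Qed.

(** For x = 2 cos t the roots are exp(it) and exp(-it); [s] is sin t, positive because |x| < 2. *)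
Lemma interior_roots {R : realType} (x : R) : x \in `]-2, 2[ ->
  exists z w : R[i],
    [/\ z * w = 1, z + w = x%:C, normc z = 1, normc w = 1 & z != w].
Proof.
rewrite in_itv/= => /andP[x2 x2'].
pose s := Num.sqrt (1 - (x / 2) ^+ 2).
have s2 : s ^+ 2 = 1 - (x / 2) ^+ 2 by rewrite sqr_sqrtr//; nra.
have s0 : 0 < s by rewrite sqrtr_gt0; nra.
exists (Complex (x / 2) s), (Complex (x / 2) (- s)); split.
- by apply/eqP; rewrite eq_complex /=; apply/andP; split; apply/eqP; [nra|ring].
- by apply/eqP; rewrite eq_complex /=; apply/andP; split; apply/eqP; field.
- by rewrite /= s2 addrCA subrr addr0 sqrtr1.
- by rewrite /= sqrrN s2 addrCA subrr addr0 sqrtr1.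
- by rewrite eq_complex /= eqxx/= -subr_eq0 opprK; apply/eqP; lra.
Qed.

Theorem theorem1 (R : realType) (v : int -> R[i]) (vl1 : in_l1Z v) :
  point_spectrum (schrodinger (in_l1Z_linfZ vl1)) `<=`
    [set lambda : R[i] |
      (~` [set x%:C | x in `]-2, 2[ : set R]) lambda /\
      normc (lambda ^+ 2 - 4) <= l1Z_norm v ^+ 2].
Proof.
move=> lambda [u /l2Z_neq0[n0 un0] Hu].
have eigen n : u (n - 1) + u (n + 1) + v n * u n = lambda * u n.
  by have /(congr1 (fun f : l2Z R => f n)) := Hu.
split=> [[x x2 xE]|].
  have [z [w [zw zDw z1 w1 neq]]] := interior_roots x x2.
  move/negP: un0; apply; apply/eqP.
  by apply: (eigen_interior_eq0 vl1 eigen zw _ z1 w1 neq); rewrite zDw.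
have [z [w [zw zDw z1]]] := exists_small_root lambda.
have -> : lambda ^+ 2 - 4 = (w - z) ^+ 2.
  by transitivity ((z + w) ^+ 2 - 4 * (z * w)); [rewrite zw zDw mulr1|ring].
have [uS supS] := sup_l2Z u; set S := sup _ in uS supS.
have S0 : 0 < S.
  apply: lt_le_trans (uS n0); rewrite lt_neqAle normc_ge0 andbT eq_sym.
  by apply: contra un0 => /eqP/ComplexField.Normc.eq0_normc ->.
rewrite expr2 normcM -expr2.
(* The pointwise bound passes to the supremum, and the factor [S], positive since [u n0] is nonzero,
   cancels. *)
have dv : normc (w - z) <= l1Z_norm v.
  rewrite -(ler_pM2r S0); apply: supS; last exact: normc_ge0.
  exact: normc_eigen_le vl1 (ltW S0) eigen zw zDw z1 uS.
by rewrite ler_pXn2r// nnegrE ?normc_ge0// (le_trans (normc_ge0 _) dv).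
Qed.
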